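(* Let $R$ be a left cu-uniserial ring. Then either $|\mathrm{Max}_l(R)|=\infty$ or $R$ is local.
   Context: All rings are associative with identity and all modules are unitary left modules. $\mathrm{Max}_l(R)$ denotes the set of all maximal left ideals of $R$. A ring is local if it has a unique maximal left ideal. For a module $K$, $\mathrm{Rad}(K)$ denotes the intersection of all maximal submodules of $K$ (equal to $K$ if there are none). A nonzero module is uniform if every nonzero submodule is essential. A left $R$-module $M$ is cyclic-uniform uniserial (cu-uniserial) if for every finitely generated submodule $0\neq K\subseteq M$, $K/\mathrm{Rad}(K)$ is cyclic and uniform. The ring $R$ is left cu-uniserial if ${}_RR$ is a cu-uniserial module. *)

(* Defs.v *)
From HB Require Import structures.
From mathcomp Require Import all_boot all_algebra.
From mathcomp Require Import generic_quotient ring_quotient.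
From mathcomp Require Import boolp classical_sets cardinality.

Set Implicit Arguments.
Unset Strict Implicit.
Unset Printing Implicit Defensive.

Import GRing.Theory.
Local Open Scope ring_scope.
Local Open Scope quotient_scope.

(* A submodule of [M] is a [submodClosed M], i.e. a boolean predicate: with the
   classical axioms of [boolp], these are all the submodules. Left ideals of [R]
   are submodules of the regular module [R^o]. *)

Section SubmoduleType.
Variables (R : nzRingType) (M : lmodType R) (K : submodClosed M).

Record submod : Type := Submod { submod_val : M; _ : submod_val \in K }.

HB.instance Definition _ := [isSub of submod for submod_val].
HB.instance Definition _ := [Choice of submod by <:].
HB.instance Definition _ := [SubChoice_isSubLmodule of submod by <:].

End SubmoduleType.

Section QuotientModule.
Variables (R : nzRingType) (M : lmodType R) (N : submodClosed M).

(* [Quotient.quot] only accepts a [zmodClosed] predicate, which is not inferred from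
   [submodClosed]. *)
Definition submod_pred : {pred M} := fun x => x \in N.

Fact submod_pred_zmod_closed : zmod_closed submod_pred.
Proof. exact: GRing.submod_closedB (GRing.submodClosedP N). Qed.

HB.instance Definition _ :=
  GRing.isZmodClosed.Build M submod_pred submod_pred_zmod_closed.

Definition quot_mod : Type := Quotient.quot submod_pred.

HB.instance Definition _ := GRing.Zmodule.on quot_mod.
HB.instance Definition _ := EqQuotient.on quot_mod.

Definition quot_scale (a : R) : quot_mod -> quot_mod :=
  lift_op1 quot_mod ( *:%R a).

Lemma pi_quot_scale (a : R) (x : M) :
  quot_scale a (\pi_quot_mod x) = \pi_quot_mod (a *: x).
Proof.
rewrite /quot_scale; unlock; apply/eqP.
rewrite -(@Quotient.idealrBE M submod_pred) -scalerBr.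
apply: rpredZ; rewrite -[_ \in _]/(_ \in submod_pred).
by rewrite (@Quotient.idealrBE M submod_pred) reprK.
Qed.

Lemma pi_quot_add (x y : M) :
  \pi_quot_mod (x + y) = \pi_quot_mod x + \pi_quot_mod y.
Proof. exact: (@Quotient.pi_add M submod_pred). Qed.

Fact quot_scaleA (a b : R) (u : quot_mod) :
  quot_scale a (quot_scale b u) = quot_scale (a * b) u.
Proof. by rewrite -[u]reprK !pi_quot_scale scalerA. Qed.

Fact quot_scale1 : left_id 1 quot_scale.
Proof. by move=> u; rewrite -[u]reprK pi_quot_scale scale1r. Qed.

Fact quot_scaleDr : right_distributive quot_scale +%R.
Proof.
move=> a u v; rewrite -[u]reprK -[v]reprK -pi_quot_add !pi_quot_scale.
by rewrite scalerDr pi_quot_add.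
Qed.

Fact quot_scaleDl (u : quot_mod) : {morph quot_scale^~ u : a b / a + b}.
Proof.
by move=> a b; rewrite -[u]reprK !pi_quot_scale scalerDl pi_quot_add.
Qed.

HB.instance Definition _ := GRing.Zmodule_isLmodule.Build R quot_mod
  quot_scaleA quot_scale1 quot_scaleDr quot_scaleDl.

End QuotientModule.

Section ModuleNotions.
Variables (R : nzRingType) (M : lmodType R).
Implicit Types N L K : submodClosed M.

Definition nonzero_module : Prop := exists x : M, x <> 0.

Definition cyclic_module : Prop := exists x : M, forall y, exists a : R, y = a *: x.

Definition finitely_generated : Prop :=
  exists (n : nat) (v : 'I_n -> M),
    forall x, exists c : 'I_n -> R, x = \sum_(i < n) c i *: v i.

Definition zero_submod N : Prop := forall x, x \in N -> x = 0.

Definition essential_submod N : Prop :=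
  forall L, (forall x, x \in N -> x \in L -> x = 0) -> zero_submod L.

Definition uniform_module : Prop :=
  nonzero_module /\ forall N, ~ zero_submod N -> essential_submod N.

Definition maximal_submod N : Prop :=
  ~ (N =i predT) /\
  forall L, {subset N <= L} -> L =i N \/ L =i predT.

(* This is all of [M] when [M] has no maximal submodule. *)
Definition Rad : {pred M} :=
  fun x => `[< forall N : submodClosed M, maximal_submod N -> x \in N >].

Fact Rad_submod_closed : submod_closed Rad.
Proof.
split; first by apply/asboolP => N _; exact: rpred0.
move=> a x y /asboolP xR /asboolP yR; apply/asboolP => N Nmax.
by apply: rpredD; [apply: rpredZ; exact: xR | exact: yR].
Qed.

HB.instance Definition _ := GRing.isSubmodClosed.Build R M Rad
  (GRing.submod_closed_semi Rad_submod_closed).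

End ModuleNotions.

Arguments Rad {R} M _.

Definition cu_uniserial (R : nzRingType) (M : lmodType R) : Prop :=
  forall K : submodClosed M,
    finitely_generated (submod K) -> ~ zero_submod K ->
    let Q := quot_mod (Rad (submod K)) in
    cyclic_module Q /\ uniform_module Q.

Definition left_cu_uniserial (R : nzRingType) : Prop := cu_uniserial R^o.

Definition Max_l (R : nzRingType) : set (set R) :=
  [set I | exists2 N : submodClosed R^o, maximal_submod N & I = [set` N]]%classic.

Arguments Max_l : clear implicits.

Definition local_ring (R : nzRingType) : Prop := exists! I : set R, Max_l R I.

(* Main.v *)
Require Import Defs.
From HB Require Import structures.
From mathcomp Require Import all_boot all_algebra.
From mathcomp Require Import generic_quotient ring_quotient.
From mathcomp Require Import boolp classical_sets cardinality.

(** A left cu-uniserial ring [R] has a uniform top [R / J], where [J] is the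
    intersection of the maximal left ideals: this is the definition applied to
    the finitely generated module [R] itself.  In a uniform module two nonzero
    submodules meet nontrivially, hence so do finitely many; pulled back to [R],
    this says that a finite intersection of left ideals containing [J] can be
    [J] only if one of them already is [J] ([uniform_quot_bigcap]).  If there
    are finitely many maximal left ideals, apply this to all of them: one of
    them is [J], so it is contained in every other maximal left ideal, and by
    maximality it is the only one ([uniform_top_unique_maximal]).

    The argument applies to every module with uniform top.  Since the
    cu-uniserial condition speaks of submodules as modules, it yields the
    uniform top of the full submodule of [R], and the conclusion is carried
    back to [R] along an isomorphism ([Max_iso]). *)

Set Implicit Arguments.
Unset Strict Implicit.
Unset Printing Implicit Defensive.

Import GRing.Theory.
Local Open Scope ring_scope.
Local Open Scope quotient_scope.
Local Open Scope classical_set_scope.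

Section SubmoduleConstructions.
Variables (R : nzRingType) (M : lmodType R).

Definition full_submod : {pred M} := fun _ => true.

Fact full_submod_closed : submod_closed full_submod.
Proof. by []. Qed.

HB.instance Definition _ := GRing.isSubmodClosed.Build R M full_submod
  (GRing.submod_closed_semi full_submod_closed).

Definition bigcap_submod (I : eqType) (F : I -> submodClosed M) (r : seq I) :
  {pred M} := fun x => all (fun i => x \in F i) r.

Fact bigcap_submod_closed (I : eqType) (F : I -> submodClosed M) r :
  submod_closed (bigcap_submod F r).
Proof.
split; first by apply/allP => i _; apply: rpred0.
move=> a x y /allP xr /allP yr; apply/allP => i ir.
by rewrite rpredD ?rpredZ ?xr ?yr.
Qed.

HB.instance Definition _ (I : eqType) (F : I -> submodClosed M) r :=
  GRing.isSubmodClosed.Build R M (bigcap_submod F r)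
    (GRing.submod_closed_semi (bigcap_submod_closed F r)).

Lemma quot_pi0 (N : submodClosed M) : \pi_(quot_mod N) 0 = 0.
Proof.
have := @pi_quot_scale R M N 0 0; rewrite scale0r => <-.
exact: (scale0r (\pi_(quot_mod N) 0)).
Qed.

Definition quot_image (N A : submodClosed M) : {pred quot_mod N} :=
  fun u => `[< exists2 x, x \in A & u = \pi_(quot_mod N) x >].

Fact quot_image_closed N A : submod_closed (@quot_image N A).
Proof.
split.
  apply/asboolP; exists 0; first exact: rpred0.
  by rewrite quot_pi0.
move=> a u v /asboolP[x xA ->] /asboolP[y yA ->]; apply/asboolP.
exists (a *: x + y); first by rewrite rpredD ?rpredZ.
by rewrite pi_quot_add -pi_quot_scale.
Qed.

HB.instance Definition _ N A :=
  GRing.isSubmodClosed.Build R (quot_mod N) (@quot_image N A)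
    (GRing.submod_closed_semi (quot_image_closed N A)).

Lemma quot_pi_eq0 (N : submodClosed M) (x : M) :
  \pi_(quot_mod N) x = 0 <-> x \in N.
Proof.
rewrite -quot_pi0.
have := @Quotient.idealrBE M (submod_pred N) x 0.
by rewrite subr0 -[x \in submod_pred N]/(x \in N) => ->; split=> /eqP.
Qed.

End SubmoduleConstructions.

Arguments full_submod {R} M _.
Arguments quot_image {R M} N A _.

Section Preimage.
Variables (R : nzRingType) (M M' : lmodType R) (f : {linear M -> M'}).

Definition preim_submod (N : submodClosed M') : {pred M} := fun x => f x \in N.

Fact preim_submod_closed N : submod_closed (preim_submod N).
Proof.
have memE x : (x \in preim_submod N) = (f x \in N) by [].
split; first by rewrite memE linear0 rpred0.
by move=> a x y; rewrite !memE linearP => xN yN; rewrite rpredD ?rpredZ.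
Qed.

HB.instance Definition _ N := GRing.isSubmodClosed.Build R M (preim_submod N)
  (GRing.submod_closed_semi (preim_submod_closed N)).

End Preimage.

(** The analogue of [Max_l] for modules: [Max_l R] is [Max R^o] by definition.
    Recording maximal submodules as sets lets them be compared and counted
    up to extensional equality. *)
Definition Max (R : nzRingType) (M : lmodType R) : set (set M) :=
  [set I | exists2 N : submodClosed M, maximal_submod N & I = [set` N]].
Arguments Max {R} M.

Section Isomorphism.
Variables (R : nzRingType) (M M' : lmodType R).

Lemma maximal_preim (f : {linear M -> M'}) (g : {linear M' -> M}) :
  cancel f g -> cancel g f ->
  forall N : submodClosed M', maximal_submod N ->
    maximal_submod (preim_submod f N : submodClosed M).
Proof.
move=> fK gK N [Nproper Nmax]; split.
  by move=> full; apply: Nproper => y; rewrite -(gK y); apply: full.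
move=> L NL.
have NL' : {subset N <= preim_submod g L}.
  by move=> y yN; apply: NL; rewrite /in_mem /= /preim_submod gK.
case: (Nmax (preim_submod g L : submodClosed M') NL') => eqL; [left|right].
  by move=> x; rewrite -{1}(fK x); apply: eqL.
by move=> x; rewrite -{1}(fK x); apply: eqL.
Qed.

Lemma Max_preim (f : {linear M -> M'}) (g : {linear M' -> M}) :
  cancel f g -> cancel g f -> forall I, Max M' I -> Max M (f @^-1` I).
Proof.
move=> fK gK _ [N Nmax ->]; exists (preim_submod f N : submodClosed M) => //.
exact: maximal_preim fK gK N Nmax.
Qed.

End Isomorphism.

Lemma Max_iso (R : nzRingType) (M M' : lmodType R)
    (f : {linear M -> M'}) (g : {linear M' -> M}) :
  cancel f g -> cancel g f -> Max M' = [set g @^-1` I | I in Max M].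
Proof.
move=> fK gK; apply/seteqP; split=> [I IM | _ [I IM <-]]; last first.
  exact: Max_preim gK fK I IM.
exists (f @^-1` I); first exact: Max_preim fK gK I IM.
by rewrite -comp_preimage; apply/seteqP; split=> y /=; rewrite gK.
Qed.

Section UniformTop.
Variables (R : nzRingType) (M : lmodType R).
Implicit Types (N A B : submodClosed M).

(** Uniformity of [M / N], read off in [M]: [N] is irreducible for the
    intersection of submodules. *)
Lemma uniform_quot_cap N A B :
  uniform_module (quot_mod N) -> {subset N <= B} ->
  (forall x, x \in A -> x \in B -> x \in N) ->
  {subset A <= N} \/ {subset B <= N}.
Proof.
move=> [_ unif] NB AB.
have zeroP C : zero_submod (quot_image N C : submodClosed (quot_mod N)) ->
    {subset C <= N}.
  move=> C0 x xC; apply/quot_pi_eq0/C0/asboolP.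
  by exists x.
have [/zeroP|nzA] := pselect (zero_submod (quot_image N A : submodClosed _)).
  by left.
right; apply/zeroP/(unif _ nzA) => u /asboolP[x xA ->] /asboolP[y yB xy].
apply/quot_pi_eq0/AB => //.
have xyN : x - y \in N.
  apply/quot_pi_eq0; rewrite pi_quot_add xy -pi_quot_add subrr.
  by apply/quot_pi_eq0/rpred0.
by rewrite -(subrK y x) rpredD // NB.
Qed.

(** Induction on the family, from the binary case.  The empty family is covered
    too: its intersection [M] is not contained in [N], because uniform modules
    are nonzero. *)
Lemma uniform_quot_bigcap N (I : eqType) (F : I -> submodClosed M) (r : seq I) :
  uniform_module (quot_mod N) ->
  {in r, forall i, {subset N <= F i}} ->
  (forall x, {in r, forall i, x \in F i} -> x \in N) ->
  exists2 i, i \in r & {subset F i <= N}.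
Proof.
move=> unif; elim: r => [|i r IHr] NF capN.
  case: unif => [[u]]; case; rewrite -(reprK u).
  by apply/quot_pi_eq0/capN.
have NFr : {in r, forall j, {subset N <= F j}}.
  by move=> j jr; apply: NF; rewrite inE jr orbT.
have [] := @uniform_quot_cap N (F i) (bigcap_submod F r) unif.
- by move=> x xN; apply/allP => j jr; apply: NFr.
- move=> x xi /allP xr; apply: capN => j; rewrite inE => /predU1P[->//|].
  exact: xr.
- by exists i; rewrite ?mem_head.
- move=> capr; have [|j jr Fj] := IHr NFr.
    by move=> x xr; apply: capr; apply/allP.
  by exists j; rewrite // inE jr orbT.
Qed.

(** The family of all maximal submodules has intersection [Rad M], so finiteness
    yields a maximal submodule [F I0] contained in [Rad M], hence in every
    other one.  The existence of [I0] is part of the same step: a uniform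
    top is nonzero, so some maximal submodule occurs in the family. *)
Lemma uniform_top_unique_maximal :
  uniform_module (quot_mod (Rad M)) -> finite_set (Max M) ->
  exists! I : set M, Max M I.
Proof.
move=> unif /finite_seqP[r rE].
(* A submodule behind each set of the list; full outside the list. *)
have /choice[F FE] (I : set M) : exists N : submodClosed M,
    I \in r -> maximal_submod N /\ I = [set` N].
  have [|Ir] := boolP (I \in r); last by exists (full_submod M : submodClosed M).
  move=> Ir; have [N Nmax NE] : Max M I by rewrite rE.
  by exists N.
have [|x xF|I0 I0r FRad] := @uniform_quot_bigcap (Rad M) _ F r unif.
- by move=> I /FE[Imax _] x /asboolP; apply.
- apply/asboolP => N Nmax.
  have Nr : [set` N] \in r.
    by have : Max M [set` N] by [exists N]; rewrite rE.
  have [_ NE] := FE _ Nr.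
  have : [set` F [set` N]] x := xF _ Nr.
  by rewrite -NE.
have [[F0proper F0max] I0E] := FE _ I0r.
exists I0; split=> [|_ [N [Nproper Nmax] ->]]; first by rewrite rE.
have F0N : {subset F I0 <= N}.
  by move=> x /FRad /asboolP; apply; split.
have [NF|/Nproper//] := F0max N F0N.
by rewrite I0E; apply/seteqP; split=> x /=; rewrite NF.
Qed.

End UniformTop.

Section FullSubmodule.
Variables (R : nzRingType) (M : lmodType R).

Definition to_full (x : M) : submod (full_submod M) :=
  @Submod R M (full_submod M) x isT.

Fact to_full_linear : linear to_full.
Proof. by move=> a x y; apply: val_inj; rewrite linearP. Qed.

HB.instance Definition _ :=
  GRing.isLinear.Build R M (submod (full_submod M)) _ to_full to_full_linear.

Lemma val_to_full : cancel to_full (val : submod (full_submod M) -> M).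
Proof. by []. Qed.

Lemma to_full_val : cancel (val : submod (full_submod M) -> M) to_full.
Proof. by move=> x; apply: val_inj. Qed.

End FullSubmodule.

Lemma regular_full_finitely_generated (R : nzRingType) :
  finitely_generated (submod (full_submod R^o)).
Proof.
exists 1, (fun=> to_full (1 : R^o)) => x; exists (fun=> (val x : R)).
by rewrite big_ord1; apply: val_inj; rewrite linearZ /= /GRing.scale /= mulr1.
Qed.

Theorem corollary2p7 (R : nzRingType) (hR : left_cu_uniserial R) :
  infinite_set (Max_l R) \/ local_ring R.
Proof.
have [fin|] := pselect (finite_set (Max_l R)); [right | by left].
pose M := submod (full_submod R^o).
have [|_ unif] := hR (full_submod R^o) (@regular_full_finitely_generated R).
  by move=> /(_ 1 isT) /eqP; rewrite oner_eq0.
have MaxM : Max M = [set val @^-1` I | I in Max R^o].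
  exact: (Max_iso (@val_to_full R R^o) (@to_full_val R R^o)).
have MaxR : Max R^o = [set @to_full R R^o @^-1` I | I in Max M].
  exact: (Max_iso (@to_full_val R R^o) (@val_to_full R R^o)).
have finM : finite_set (Max M) by rewrite MaxM; apply: finite_image.
have [I [IM Iuniq]] := uniform_top_unique_maximal unif finM.
rewrite /local_ring -[Max_l R]/(Max R^o) MaxR.
exists (@to_full R R^o @^-1` I); split; first by exists I.
by move=> _ [L LM <-]; rewrite (Iuniq L LM).
Qed.
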